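(* For $3\le n\le 37$, the minimum number $m(n)$ of edges of a pancyclic graph on $n$ vertices has the following values: $m(3)=3$; $m(n)=n+1$ for $4\le n\le 5$; $m(n)=n+2$ for $6\le n\le 8$; $m(n)=n+3$ for $9\le n\le 14$; $m(n)=n+4$ for $15\le n\le 24$; and $m(n)=n+5$ for $25\le n\le 37$.
   Context: All graphs are finite and simple. A graph on $n\geq 3$ vertices is pancyclic if it contains a cycle of length $\ell$ for every integer $\ell$ with $3\le \ell\le n$. For $n\ge 3$, $m(n)$ denotes the minimum number of edges among all pancyclic graphs on $n$ vertices. *)

(* Defs.v *)
From HB Require Import structures.
From mathcomp Require Import all_boot.

Set Implicit Arguments.
Unset Strict Implicit.
Unset Printing Implicit Defensive.

(* Edges are unordered pairs of distinct vertices, i.e. 2-element sets, so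
   #|edges G| counts each edge once. *)
Record sgraph (T : finType) := SGraph {
  edges : {set {set T}};
  edges_pairs : [forall e in edges, #|e| == 2]
}.

HB.instance Definition _ (T : finType) := [isSub for @edges T].
HB.instance Definition _ (T : finType) := [Finite of sgraph T by <:].

Section Graph.

Variables (T : finType) (G : sgraph T).

(* Irreflexive: [set x; x] has one element, hence is not an edge. *)
Definition adj : rel T := [rel x y | [set x; y] \in edges G].

(* The bound on l excludes the degenerate closed walks (a single vertex, or an
   edge traversed back and forth) that ucycleb does not rule out by itself. *)
Definition has_cycle (l : nat) : bool :=
  (3 <= l) && [exists c : l.-tuple T, ucycleb adj c].

(* l ranges over all the integers 0 <= l <= #|T|. *)
Definition pancyclic : bool :=
  [forall l : 'I_#|T|.+1, (3 <= l) ==> has_cycle l].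

End Graph.

Definition pancyclic_size (n : nat) : pred nat :=
  [pred k | [exists G : sgraph 'I_n, pancyclic G && (#|edges G| == k)]].

Lemma complete_pairs (T : finType) :
  [forall e in [set e : {set T} | #|e| == 2], #|e| == 2].
Proof. by apply/forall_inP => e; rewrite inE. Qed.

Definition complete (T : finType) : sgraph T := SGraph (complete_pairs T).

Lemma complete_adj (T : finType) (x y : T) : adj (complete T) x y = (x != y).
Proof. by rewrite /adj /= inE cards2; case: (x != y). Qed.

Lemma complete_ucycle (T : finType) (s : seq T) :
  1 < size s -> uniq s -> ucycleb (adj (complete T)) s.
Proof.
move=> s_gt1 Us; rewrite /ucycleb Us andbT (cycle_from_next Us) // => x xs.
rewrite complete_adj; apply: contraTneq s_gt1 => xE.
have := Us; have [i p rotE] := rot_to xs.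
rewrite -(rot_uniq i) -(size_rot i) -leqNgt => Ur.
move: xE; rewrite -(next_rot i Us) rotE; case: p rotE => [//|y p] rotE /=.
by rewrite eqxx => xy; move: Ur; rewrite rotE xy /= inE eqxx.
Qed.

Lemma complete_pancyclic (T : finType) : pancyclic (complete T).
Proof.
apply/forallP => l; apply/implyP => l_ge3; rewrite /has_cycle l_ge3 /=.
have size_c : size (take l (enum T)) == l.
  by rewrite size_takel // -cardE -ltnS.
apply/existsP; exists (Tuple size_c); apply: complete_ucycle => /=.
  by rewrite (eqP size_c) ltnW.
exact: take_uniq (enum_uniq T).
Qed.

Lemma pancyclic_size_ex (n : nat) : exists k, pancyclic_size n k.
Proof.
exists #|edges (complete 'I_n)|; apply/existsP; exists (complete 'I_n).
by rewrite complete_pancyclic eqxx.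
Qed.

(* The minimum number m(n) of edges of a pancyclic graph on n vertices, which
   exists because complete graphs are pancyclic; meaningful for n >= 3, as
   pancyclicity is vacuous on fewer vertices. *)
Definition m (n : nat) : nat := ex_minn (pancyclic_size_ex n).

(* Main.v *)
Require Import Defs.
From mathcomp Require Import all_boot zify.
Set Implicit Arguments.
Unset Strict Implicit.
Unset Printing Implicit Defensive.

(** A pancyclic graph on n vertices has a Hamiltonian cycle, so it has n + k
    edges, where k is the number of its chords, the edges off that cycle.  The
    question is which n allow a given k.

    Lower bounds.  The edge set of a cycle meets every vertex in an even number
    of edges.  Along the Hamiltonian cycle this parity condition propagates, so
    an even edge set is determined by its set of chords up to exchanging its
    Hamiltonian edges for the other ones: there are only two even sets for each
    set of chords.  A cycle is moreover minimal among nonempty even sets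
    ([cycle_edges_even_set], [cycle_edges_minimal], [cycle_attains]); this
    discards, for instance, two disjoint cycles taken together.  Which even sets
    are minimal depends only on the cyclic pattern of the chord endpoints and on
    which of the 2k gaps between consecutive endpoints are empty, and the size
    of an even set is the number of its chords plus the sum of the gaps that it
    contains ([arrangement_search]).

    For each pattern there remains a finite problem about 2k gaps of sum n:
    every length from 3 to n - 1 has to be attained by one of at most
    2 (2 ^ k - 1) circuits.  [search] branches on the smallest length not yet
    attained.  A circuit can be that short only if its gaps are small; assigning
    them often empties gaps, which destroys further circuits, and a branch dies
    as soon as the missing lengths outnumber the circuits still open.  Rotating
    the Hamiltonian cycle so that its last gap is the largest ([best_rotation])
    removes most of the symmetry.  The search is proved to succeed whenever the
    gaps of a pancyclic graph exist ([search_sound], [pancyclic_search]), and it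
    is computed to fail in all the cases that matter ([search_fails]).

    Upper bounds.  Explicit lists of chords attain the bounds; all the required
    cycles are traced and checked by computation ([pancyclic_check_sound],
    [chord_table_check]). *)

(** * Searching for the gaps between chord endpoints *)

Fixpoint dot (d : seq bool) (g : seq nat) : nat :=
  match d, g with
  | b :: d', x :: g' => (if b then x else 0) + dot d' g'
  | _, _ => 0
  end.

Fixpoint mask_sub (s t : seq bool) : bool :=
  match s, t with a :: s', b :: t' => (a ==> b) && mask_sub s' t' | _, _ => true end.

Fixpoint mask_diff (s t : seq bool) : seq bool :=
  match s, t with a :: s', b :: t' => (a && ~~ b) :: mask_diff s' t' | _, _ => [::] end.

(** A circuit is known by its number of chords and by the gaps it contains.
    Each obstruction marks gaps that cannot all be empty: if they were, a proper
    even subset would split the circuit. *)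
Record circuit := Circuit {
  chord_count : nat;
  circuit_vec : seq bool;
  obstructions : seq (seq bool) }.

Definition circuit_length (c : circuit) (g : seq nat) : nat :=
  chord_count c + dot (circuit_vec c) g.

Definition genuine (c : circuit) (g : seq nat) : bool :=
  all (fun d => 0 < dot d g) (obstructions c).

(** The length n is left out, as it is attained by the Hamiltonian cycle. *)
Definition covers (n : nat) (cs : seq circuit) (g : seq nat) : Prop :=
  forall l, 3 <= l < n -> has (fun c => genuine c g && (circuit_length c g == l)) cs.

Notation assignment := (seq (option nat)).

Definition agrees (a : assignment) (g : seq nat) : bool :=
  all2 (fun o x => if o is Some v then v == x else true) a g.

Fixpoint maybe_positive (a : assignment) (d : seq bool) : bool :=
  match a, d with
  | o :: a', b :: d' =>
    if b then (if o is Some 0 then maybe_positive a' d' else true)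
    else maybe_positive a' d'
  | _, _ => false
  end.

Definition maybe_genuine (a : assignment) (c : circuit) : bool :=
  all (maybe_positive a) (obstructions c).

Variant valuation := Determined of nat | Undetermined of nat.

(** A circuit with s chords has a determined length as soon as all the gaps
    inside it are known, or all the gaps outside it, since the gaps add up to n.
    Otherwise the result is the part of its length that is known.  The
    accumulators kin and kout collect the known gaps inside (on top of s) and
    outside, and uin and uout record whether an unknown gap was met there. *)
Fixpoint valuate (n s : nat) (a : assignment) (d : seq bool) (kin kout : nat)
    (uin uout : bool) : valuation :=
  match a, d with
  | Some v :: a', true :: d' => valuate n s a' d' (v + kin) kout uin uout
  | Some v :: a', false :: d' => valuate n s a' d' kin (v + kout) uin uout
  | None :: a', true :: d' => valuate n s a' d' kin kout true uout
  | None :: a', false :: d' => valuate n s a' d' kin kout uin true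
  | _, _ =>
    if uin then if uout then Undetermined kin else Determined (s + (n - kout))
    else Determined kin
  end.

Fixpoint clear (v : nat) (s : seq bool) {struct s} : seq bool :=
  if s is x :: s' then (if v is v'.+1 then x :: clear v' s' else false :: s')
  else [::].

(** Entry l of missing tells whether the length l is still to be attained; open
    collects the circuits of undetermined length. *)
Fixpoint classify (n : nat) (a : assignment) (cs : seq circuit)
    (missing : seq bool) (open : seq (nat * seq bool)) :=
  if cs is c :: cs' then
    match valuate n (chord_count c) a (circuit_vec c) (chord_count c) 0 false false with
    | Determined v => classify n a cs' (clear v missing) open
    | Undetermined v => classify n a cs' missing ((v, circuit_vec c) :: open)
    end
  else (missing, open).

Fixpoint outnumbers (missing : seq bool) (open : seq (nat * seq bool)) : bool :=
  match missing with
  | [::] => false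
  | true :: m' => if open is _ :: o' then outnumbers m' o' else true
  | false :: m' => outnumbers m' open
  end.

(** All the ways to give the unknown gaps in d the total r. *)
Fixpoint distribute (a : assignment) (d : seq bool) (r : nat) : seq assignment :=
  match a, d with
  | None :: a', true :: d' =>
    flatten [seq [seq Some v :: t | t <- distribute a' d' (r - v)] | v <- iota 0 r.+1]
  | o :: a', _ :: d' => [seq o :: t | t <- distribute a' d' r]
  | _, _ => if r is 0 then [:: a] else [::]
  end.

Definition known_total (a : assignment) : nat := sumn (pmap id a).

(** The last gap is the largest one, hence at least n divided by the number of
    gaps, and while it is unknown it is at most what the known gaps leave over.
    The mask fb marks the gaps that are not allowed to be empty. *)
Definition admissible (n : nat) (fb : seq bool) (a : assignment) : bool :=
  let t := known_total a in
  if t <= n then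
    let ub := if last None a is Some v then v else n - t in
    if n <= size a * ub then
      all2 (fun o b => if o is Some v then (if v is 0 then ~~ b else v <= ub) else true)
        a fb
    else false
  else false.

Definition lengths_below (n : nat) : seq bool := nseq 3 false ++ nseq (n - 3) true.

(** The answer true means that a solution has not been excluded; this includes
    running out of fuel, so that soundness holds for every amount of fuel.  A
    recursive call assigns at least one more gap. *)
Fixpoint search (n : nat) (fb : seq bool) (fuel : nat) (a : assignment)
    (cs : seq circuit) : bool :=
  if fuel is fuel'.+1 then
    if admissible n fb a then
      let cs := filter (maybe_genuine a) cs in
      let (missing, open) := classify n a cs (lengths_below n) [::] in
      if outnumbers missing open then false
      else if has id missing then
        let l := find id missing in
        has (fun u => if u.1 <= l
                      then has (fun a' => search n fb fuel' a' cs)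
                               (distribute a u.2 (l - u.1))
                      else false) open
      else true
    else false
  else true.

Fixpoint known_dot (a : assignment) (d : seq bool) : nat :=
  match a, d with
  | o :: a', b :: d' => (if b then odflt 0 o else 0) + known_dot a' d'
  | _, _ => 0
  end.

Lemma dot_neg d g : size d = size g -> dot d g + dot (map negb d) g = sumn g.
Proof.
elim: d g => [|b d IH] [|x g] //= [/IH <-].
by case: b; rewrite /= add0n; [rewrite addnA | rewrite addnCA].
Qed.

Lemma known_dot_le a d g : agrees a g -> known_dot a d <= dot d g.
Proof.
elim: a d g => [|o a IH] [|b d] [|x g] //= /andP[ox ag].
rewrite leq_add ?IH //; case: b => //; case: o ox => //= v /eqP-> //.
Qed.

Lemma maybe_positive_sound a d g : agrees a g -> 0 < dot d g -> maybe_positive a d.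
Proof.
elim: a d g => [|o a IH] [|b d] [|x g] //= /andP[ox ag].
case: b => /=; last by rewrite add0n; apply: IH.
case: o ox => [[|v]|] //= /eqP <-; exact: IH.
Qed.

Lemma maybe_genuine_sound a c g : agrees a g -> genuine c g -> maybe_genuine a c.
Proof. by move=> ag; apply: sub_all => d; apply: maybe_positive_sound. Qed.

Lemma covers_filter n a cs g :
  agrees a g -> covers n cs g -> covers n (filter (maybe_genuine a) cs) g.
Proof.
move=> ag cov l /cov {cov}; elim: cs => //= c cs IH /orP[/andP[gc lc]|/IH].
  by rewrite (maybe_genuine_sound ag gc) /= gc lc.
by case: ifP => //= _ ->; rewrite orbT.
Qed.

Lemma valuate_sound n s a d g kin kout uin uout : agrees a g -> size d = size g ->
  match valuate n s a d kin kout uin uout with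
  | Determined v => (~~ uin && (v == kin + dot d g))
      || (~~ uout && (v == s + (n - (kout + dot (map negb d) g))))
  | Undetermined v => v == kin + known_dot a d
  end.
Proof.
elim: a d g kin kout uin uout => [|o a IH] [|b d] [|x g] //= kin kout uin uout.
  by case: uin; case: uout; rewrite //= ?addn0 ?eqxx.
move=> /andP[ox ag] [sz].
case: o ox => [v|_] /= => [/eqP->|]; case: b => /=; rewrite ?add0n.
- move: (IH d g (x + kin) kout uin uout ag sz); case: valuate => v'.
    by rewrite -[x + kin + _]addnA [x + (_ + _)]addnCA.
  by move/eqP->; rewrite -[x + kin + _]addnA [x + (_ + _)]addnCA.
- move: (IH d g kin (x + kout) uin uout ag sz); case: valuate => v' //.
  by rewrite -[x + kout + _]addnA [x + (_ + _)]addnCA.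
- move: (IH d g kin kout true uout ag sz); case: valuate => v' //=.
  by move->; rewrite orbT.
- move: (IH d g kin kout uin true ag sz); case: valuate => v' //=.
  by rewrite orbF => ->.
Qed.

Lemma determined_length n a c g v :
  agrees a g -> size (circuit_vec c) = size g -> sumn g = n ->
  valuate n (chord_count c) a (circuit_vec c) (chord_count c) 0 false false
    = Determined v -> v = circuit_length c g.
Proof.
move=> ag sz sg E; have := valuate_sound n (chord_count c) (chord_count c) 0 false false ag sz.
rewrite E /= add0n -sg -(dot_neg sz) addnK => /orP[]/eqP -> //.
Qed.

(** For an open circuit, paired with the known part of its length, what its
    length will be under the gaps g. *)
Definition completed_length (a : assignment) (g : seq nat) (u : nat * seq bool) :=
  u.1 + (dot u.2 g - known_dot a u.2).

Lemma undetermined_length n a c g v :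
  agrees a g -> size (circuit_vec c) = size g ->
  valuate n (chord_count c) a (circuit_vec c) (chord_count c) 0 false false
    = Undetermined v -> completed_length a g (v, circuit_vec c) = circuit_length c g.
Proof.
move=> ag sz E; have := valuate_sound n (chord_count c) (chord_count c) 0 false false ag sz.
rewrite E /completed_length /= => /eqP->.
by rewrite -addnA subnKC // known_dot_le.
Qed.

Lemma nth_clear v s l : nth false (clear v s) l = (l != v) && nth false s l.
Proof.
elim: s v l => [|x s IH] [|v] [|l] //=; rewrite ?nth_nil ?andbF ?eqSS //.
Qed.

(** A length that is still missing in the end is not that of a determined
    circuit; if some circuit has it, that circuit is open. *)
Lemma classify_sound n a cs g missing open l :
  agrees a g -> sumn g = n -> all (fun c => size (circuit_vec c) == size g) cs ->
  let: (missing', open') := classify n a cs missing open in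
  nth false missing' l ->
  nth false missing l /\
  ((l \in map (completed_length a g) open) || has (fun c => circuit_length c g == l) cs ->
   l \in map (completed_length a g) open').
Proof.
move=> ag sg; elim: cs missing open => [|c cs IH] missing open /=.
  by rewrite orbF.
case/andP=> /eqP sz szs.
case E: valuate => [v|v].
  have v_len := determined_length ag sz sg E.
  move: (IH (clear v missing) open szs).
  case: classify => m' o' H /H {H}; rewrite nth_clear => -[/andP[lv ->] H].
  by split=> //; move: H; rewrite v_len in lv; rewrite [_ == l]eq_sym (negPf lv).
move: (IH missing ((v, circuit_vec c) :: open) szs).
case: classify => m' o' H /H {H} [-> H]; split=> // H'; apply: H.
rewrite /= inE (undetermined_length ag sz E) [l == _]eq_sym.
by case: (_ == l) H'.
Qed.

Lemma classify_vec_size n a cs missing open r :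
  all (fun c => size (circuit_vec c) == r) cs -> all (fun u => size u.2 == r) open ->
  all (fun u => size u.2 == r) (classify n a cs missing open).2.
Proof.
elim: cs missing open => //= c cs IH missing open /andP[cr csr] opr.
by case: valuate => v; apply: IH; rewrite //= cr.
Qed.

Lemma outnumbersE missing open : outnumbers missing open = (size open < count id missing).
Proof.
elim: missing open => [|[] m IH] [|u o] //=; rewrite ?IH ?add0n //.
Qed.

(** Pigeonhole principle behind the test [outnumbers]. *)
Lemma count_positions (s : seq bool) (T : seq nat) :
  (forall l, nth false s l -> l \in T) -> count id s <= size T.
Proof.
move=> sT; pose P := [seq l <- iota 0 (size s) | nth false s l].
have -> : count id s = size P.
  by rewrite size_filter -(count_map (nth false s) id) map_nth_iota0 // take_size.
apply: uniq_leq_size => [|l]; first by rewrite filter_uniq ?iota_uniq.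
by rewrite mem_filter => /andP[/sT].
Qed.

Lemma distribute_sound a d g r : agrees a g -> size d = size g ->
  dot d g = known_dot a d + r -> has (agrees^~ g) (distribute a d r).
Proof.
elim: a d g r => [|o a IH] [|b d] [|x g] r //=.
  by move=> _ _; rewrite add0n => <-.
move=> /andP[ox ag] [sz].
have keep r' : has (agrees^~ g) (distribute a d r') ->
    has (agrees^~ (x :: g)) [seq o :: t | t <- distribute a d r'].
  by rewrite has_map; apply: sub_has => t /= ->; rewrite andbT.
case: b => /=; last first.
  rewrite !add0n => /(IH _ _ _ ag sz) H; case: o ox keep => [v|] _ keep; exact: keep.
case: o ox keep => [v /eqP-> keep|_ _] /=.
  by rewrite -addnA => /addnI /(IH _ _ _ ag sz) /keep.
rewrite add0n => E.
have [le_xr] : x <= r /\ dot d g = known_dot a d + (r - x).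
  have := known_dot_le d ag; rewrite addnC in E.
  move=> kd; have le_xr : x <= r by rewrite -(leq_add2l (known_dot a d)) -E leq_add2r.
  by split=> //; apply/eqP; rewrite -(eqn_add2r x) E -addnA subnK.
move=> /(IH _ _ _ ag sz) /hasP[t tin tg].
apply/hasP; exists (Some x :: t); last by rewrite /= eqxx.
apply/(@flattenP _ [seq [seq Some v :: t | t <- distribute a d (r - v)] | v <- iota 0 r.+1]).
exists [seq Some x :: t | t <- distribute a d (r - x)]; last exact: map_f.
by apply/mapP; exists x; rewrite ?mem_iota ?add0n ?ltnS.
Qed.

Lemma agrees_rcons a o g x :
  agrees (rcons a o) (rcons g x) = agrees a g && (if o is Some v then v == x else true).
Proof.
rewrite /agrees !all2E !size_rcons eqSS; case: eqP => //= sz.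
by rewrite zip_rcons // all_rcons andbC.
Qed.

(** The last gap is added when it is unknown, because this is how [admissible]
    bounds it. *)
Lemma known_total_le a g : agrees a g ->
  known_total a + (if last None a is Some _ then 0 else last 0 g) <= sumn g.
Proof.
rewrite /known_total; case/lastP: a => [|a o]; first by case: g.
case/lastP: g => [|g x]; first by case: a.
rewrite agrees_rcons !last_rcons -!cats1 sumn_cat pmap_cat sumn_cat /= addn0.
case/andP=> ag ox; rewrite -addnA; apply: leq_add.
  elim: a g ag => [|o' a IH] [|x' g] //= /andP[ox' /IH H].
  by case: o' ox' => [v /= /eqP->|_] /=; rewrite ?leq_add2l // (leq_trans H) ?leq_addl.
by case: o ox => [v /eqP->|_] /=; rewrite ?addn0.
Qed.

Lemma agrees_last a g : agrees a g ->
  if last None a is Some v then v == last 0 g else true.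
Proof.
case/lastP: a => [|a o]; first by case: g.
case/lastP: g => [|g x]; first by case: a.
by rewrite agrees_rcons !last_rcons => /andP[].
Qed.

Lemma sumn_le_size (g : seq nat) b : all (leq^~ b) g -> sumn g <= size g * b.
Proof. by elim: g => //= x g IH /andP[xb /IH]; rewrite mulSn; apply: leq_add. Qed.

Definition respects (fb : seq bool) (g : seq nat) : bool :=
  all2 (fun (b : bool) x => b ==> (x != 0)) fb g.

Lemma admissible_sound n fb a g : agrees a g -> sumn g = n -> respects fb g ->
  all (leq^~ (last 0 g)) g -> admissible n fb a.
Proof.
move=> ag sg fg gmax; have tot := known_total_le ag; have lst := agrees_last ag.
have sz : size a = size g by move: ag; rewrite /agrees all2E => /andP[/eqP].
rewrite /admissible -sg (leq_trans _ tot) ?leq_addr //.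
set ub := (X in size a * X); rewrite -/ub.
have lub : last 0 g <= ub.
  rewrite /ub; case: last tot lst => [v _ /eqP->|] // tot _.
  by rewrite leq_subRL ?(leq_trans _ tot) // leq_addr.
have gub : all (leq^~ ub) g by apply: sub_all gmax => x xl; exact: leq_trans lub.
rewrite sz sumn_le_size //; clearbody ub.
elim: a fb g ag fg gub {tot lst sz gmax sg lub} => [|o a IH] [|b fb] [|x g] //=.
case/andP=> ox ag /andP[bx fg] /andP[xu gu]; rewrite (IH _ _ ag fg gu) andbT.
case: o ox => [v /eqP->|] //; case: x bx xu => [|x] //; by case: b.
Qed.

(** Following the branch of g, the smallest missing length is that of an open
    circuit, and one of the distributions tried for this circuit agrees with
    g. *)
Lemma search_sound n fb fuel a cs g :
  agrees a g -> sumn g = n -> respects fb g -> all (leq^~ (last 0 g)) g ->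
  all (fun c => size (circuit_vec c) == size g) cs ->
  covers n cs g -> search n fb fuel a cs.
Proof.
move=> + sg fg gmax; elim: fuel a cs => //= fuel IH a cs ag szs cov.
rewrite (admissible_sound ag sg fg gmax).
move: (covers_filter ag cov).
have : all (fun c => size (circuit_vec c) == size g) (filter (maybe_genuine a) cs).
  by rewrite all_filter; apply: sub_all szs => c /= ->; rewrite implybT.
move: (filter _ cs) => {cov szs} cs szs cov.
have := classify_sound (lengths_below n) [::] _ ag sg szs.
have szo : all (fun u => size u.2 == size g)
    (classify n a cs (lengths_below n) [::]).2 by apply: classify_vec_size.
case: classify szo => missing open /= szo H.
have {}H l : nth false missing l -> l \in map (completed_length a g) open.
  move=> lm; have [lb] := H l lm; apply; apply: sub_has (cov l _) => [c|].
    by case/andP.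
  move: lb; rewrite /lengths_below nth_cat size_nseq !nth_nseq.
  case: (ltnP l 3) => [_ //|l3].
  by case: ifP => //; rewrite ltn_sub2rE.
rewrite outnumbersE ltnNge -(size_map (completed_length a g)) count_positions //.
case: ifP => // hm; have := nth_find false hm; set l := find _ _ => /H /mapP[[u d] uo lE].
apply/hasP; exists (u, d) => //=; rewrite lE /completed_length /= leq_addr addKn.
have [t tin tg] := hasP (distribute_sound ag (eqP (allP szo _ uo))
  (esym (subnKC (known_dot_le d ag)))).
by apply/hasP; exists t => //; apply: IH.
Qed.

(** * Circuits of a chord word *)

(** Walking along the Hamiltonian cycle, each chord is met twice and chords are
    numbered in the order of their first endpoints.  In open are the chords met
    once so far; next is the next new number.  There are
    (2k - 1)(2k - 3) ... 1 such words. *)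
Fixpoint words_from (len : nat) (open : seq nat) (next unopened : nat) : seq (seq nat) :=
  if len is len'.+1 then
    (if unopened is u.+1
     then [seq next :: w | w <- words_from len' (next :: open) next.+1 u] else [::])
    ++ flatten [seq [seq t :: w | w <- words_from len' (seq.rem t open) next unopened]
               | t <- open]
  else [:: [::]].

Definition chord_words (k : nat) : seq (seq nat) := words_from k.*2 [::] 0 k.

(** The gaps inside the even set with chords sg: membership switches at each
    endpoint of a chord of sg, starting from e. *)
Fixpoint side_vec (sg : seq bool) (w : seq nat) (e : bool) : seq bool :=
  if w is t :: w' then let e' := e (+) nth false sg t in e' :: side_vec sg w' e' else [::].

Fixpoint masks (k : nat) : seq (seq bool) :=
  if k is k'.+1
  then [seq false :: s | s <- masks k'] ++ [seq true :: s | s <- masks k']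
  else [:: [::]].

(** An obstruction that contains another one adds nothing to the conjunction. *)
Definition minimal_masks (ds : seq (seq bool)) : seq (seq bool) :=
  foldr (fun d acc => if has (fun t => mask_sub t d) acc then acc
                      else d :: filter (fun t => ~~ mask_sub d t) acc) [::] ds.

(** An even set with a nonempty proper subset t of the chords, on either side,
    obstructs the circuit unless it has a nonempty gap outside the circuit. *)
Definition word_circuit (ms : seq (seq bool)) (w : seq nat) (sg : seq bool) (e : bool) :=
  let d := side_vec sg w e in
  Circuit (count id sg) d (minimal_masks (flatten
    [seq [:: mask_diff (side_vec t w false) d; mask_diff (side_vec t w true) d]
    | t <- ms & [&& has id t, mask_sub t sg & ~~ mask_sub sg t]])).

(** A candidate with an obstruction that marks no gap is never a circuit. *)
Definition word_circuits (k : nat) (w : seq nat) : seq circuit :=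
  let ms := masks k in
  filter (fun c => all (has id) (obstructions c))
    (flatten [seq [:: word_circuit ms w sg false; word_circuit ms w sg true]
             | sg <- ms & has id sg]).

(** Endpoints at the same vertex are listed by increasing chord number, so an
    empty gap is possible only between increasing numbers.  The last
    gap, which closes the cycle, may be empty. *)
Fixpoint nonzero_gaps (w : seq nat) : seq bool :=
  match w with
  | t :: ((u :: _) as w') => (u <= t) :: nonzero_gaps w'
  | _ :: [::] => [:: false]
  | [::] => [::]
  end.

(** Fuel 9 is enough for up to four chords, which leave 8 gaps to assign. *)
Definition pancyclic_candidate (k : nat) (ns : seq nat) : bool :=
  has (fun w => let cs := word_circuits k w in let fb := nonzero_gaps w in
         has (fun n => search n fb 9 (nseq k.*2 None) cs) ns)
      (chord_words k).

Lemma mem_masks k s : (s \in masks k) = (size s == k).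
Proof.
elim: k s => [|k IH] [|b s] //=.
  by rewrite mem_cat; apply/negbTE/negP => /orP[]/mapP[].
rewrite mem_cat eqSS -IH; apply/orP/idP => [[]/mapP[t tm [_ ->]]//|sm].
by case: b; [right|left]; apply: map_f.
Qed.

Lemma mem_minimal_masks ds : {subset minimal_masks ds <= ds}.
Proof.
elim: ds => //= d ds IH t; case: ifP => _.
  by move/IH; rewrite inE orbC => ->.
by rewrite !inE mem_filter => /orP[->//|/andP[_ /IH->]]; rewrite orbT.
Qed.

Lemma dot_gt0_has d g : 0 < dot d g -> has id d.
Proof. by elim: d g => [|[] d IH] [|x g] //=; rewrite add0n; apply: IH. Qed.

Lemma size_side_vec sg w e : size (side_vec sg w e) = size w.
Proof. by elim: w e => //= t w IH e; rewrite IH. Qed.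

(** Length l is that of a set of chords with a choice of side, no proper part of
    which is even. *)
Definition attains (k : nat) (w g : seq nat) (l : nat) : Prop :=
  exists sg e, [/\ size sg = k, has id sg,
    l = count id sg + dot (side_vec sg w e) g &
    forall t e', size t = k -> has id t -> mask_sub t sg -> ~~ mask_sub sg t ->
      0 < dot (mask_diff (side_vec t w e') (side_vec sg w e)) g].

Lemma word_circuits_cover k w g n :
  (forall l, 3 <= l < n -> attains k w g l) -> covers n (word_circuits k w) g.
Proof.
move=> H l /H[sg [e [sz nz -> gen]]].
have gc : forall d, d \in obstructions (word_circuit (masks k) w sg e) -> 0 < dot d g.
  move=> d /mem_minimal_masks /flattenP[ds /mapP[t]]; rewrite mem_filter mem_masks.
  move=> /andP[/and3P[tz ts st] /eqP tk] ->.
  by rewrite !inE => /orP[]/eqP->; apply: gen.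
have tr : all (has id) (obstructions (word_circuit (masks k) w sg e)).
  by apply/allP => d /gc /dot_gt0_has.
rewrite /word_circuits.
(* Filtering is removed first, then the candidate is located in the list. *)
suff: has (fun c => all (has id) (obstructions c) &&
    (genuine c g && (circuit_length c g == count id sg + dot (side_vec sg w e) g)))
    (flatten [seq [:: word_circuit (masks k) w sg false; word_circuit (masks k) w sg true]
             | sg <- masks k & has id sg]).
  elim: (flatten _) => //= c cs IH.
  by case: (all _ (obstructions c)) => //= /orP[->|/IH ->]; rewrite ?orbT.
have: sg \in [seq sg <- masks k | has id sg] by rewrite mem_filter nz mem_masks sz eqxx.
elim: [seq _ <- _ | _] => //= s ss IH; rewrite inE => /orP[/eqP E|/IH]; last first.
  by move=> ->; rewrite !orbT.
by subst s; case: e gc tr {gen IH} => gc tr; rewrite tr /genuine;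
   rewrite (introT allP gc) /circuit_length /= eqxx ?orbT.
Qed.

Lemma word_circuits_size k w :
  all (fun c => size (circuit_vec c) == size w) (word_circuits k w).
Proof.
rewrite all_filter; elim: [seq _ <- _ | _] => //= sg s ->.
by rewrite !size_side_vec eqxx !implybT.
Qed.

Lemma agrees_nseq m g : size g = m -> agrees (nseq m None) g.
Proof. by move=> <-; elim: g. Qed.

Lemma pancyclic_candidate_sound k ns n w g :
  n \in ns -> w \in chord_words k -> size w = k.*2 -> size g = k.*2 -> sumn g = n ->
  respects (nonzero_gaps w) g -> all (leq^~ (last 0 g)) g ->
  (forall l, 3 <= l < n -> attains k w g l) -> pancyclic_candidate k ns.
Proof.
move=> nns wk sw sg sn rg mg /word_circuits_cover cov.
apply/hasP; exists w => //; apply/hasP; exists n => //.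
apply: search_sound cov => //; first exact: agrees_nseq.
by rewrite sg -sw; apply: word_circuits_size.
Qed.

(** * Chord positions as words and gaps *)

(** An endpoint is a pair of a position and a chord number. *)
Definition endpoint_le : rel (nat * nat) :=
  fun x y => (x.1 < y.1) || (x.1 == y.1) && (x.2 <= y.2).

Lemma endpoint_le_total : total endpoint_le.
Proof.
by move=> [a b] [c d]; rewrite /endpoint_le /=; case: ltngtP => //= _; exact: leq_total.
Qed.

Lemma endpoint_le_trans : transitive endpoint_le.
Proof.
move=> [a b] [c d] [e f]; rewrite /endpoint_le /=.
case/orP=> [ca|/andP[/eqP-> db]] /orP[ae|/andP[/eqP<- bf]].
- by rewrite (ltn_trans ca ae).
- by rewrite ca.
- by rewrite ae.
- by rewrite ltnn eqxx (leq_trans db).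
Qed.

Lemma endpoint_le_fst x y : endpoint_le x y -> x.1 <= y.1.
Proof. by case/orP=> [/ltnW//|/andP[/eqP->]]. Qed.

Section Words.
Variables p q : nat -> nat.

(** The least endpoint still to come is the second end of an open chord or the
    first end of the chord nx: other chords start later, or at the same place
    with a larger number. *)
Lemma word_in_words_from E op nx u :
  (forall t, nx <= t < nx + u -> p t < q t) ->
  (forall s t, nx <= s -> s <= t < nx + u -> p s <= p t) ->
  perm_eq E ([seq (q t, t) | t <- op] ++
             flatten [seq [:: (p t, t); (q t, t)] | t <- iota nx u]) ->
  sorted endpoint_le E -> map snd E \in words_from (size E) op nx u.
Proof.
elim: E op nx u => [|x E IH] op nx u // pq pm pE xE.
have [sE xmin] : sorted endpoint_le E /\ all (endpoint_le x) E.
  by move: xE => /=; rewrite (path_sortedE endpoint_le_trans) => /andP[-> ->].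
have : x \in x :: E by apply: mem_head.
have xminE y : y \in [seq (q t, t) | t <- op] ++
             flatten [seq [:: (p t, t); (q t, t)] | t <- iota nx u] -> endpoint_le x y.
  rewrite -(perm_mem pE) inE => /orP[/eqP->|/(allP xmin)//].
  by rewrite /endpoint_le ltnn eqxx leqnn.
rewrite (perm_mem pE) mem_cat => /orP[/mapP[t top xt]|/flattenP[r /mapP[t]]].
  rewrite [words_from _ _ _ _]/= mem_cat; apply/orP; right; apply/flattenP.
  exists [seq t :: w | w <- words_from (size E) (seq.rem t op) nx u]; first exact: map_f.
  rewrite xt /=; apply/map_f; apply: IH => //; rewrite -(perm_cons x); apply: perm_trans pE _.
  rewrite xt -cat_cons perm_cat2r.
  rewrite -[(q t, t) :: _]/(map (fun t => (q t, t)) (t :: seq.rem t op)).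
  by apply: perm_map; apply: perm_to_rem.
rewrite mem_iota => tu -> xt.
have tin y : y \in [:: (p t, t); (q t, t)] -> endpoint_le x y.
  move=> yt; apply: xminE; rewrite mem_cat; apply/orP; right; apply/flattenP.
  by exists [:: (p t, t); (q t, t)] => //; apply/mapP; exists t; rewrite ?mem_iota.
have {}xt : x = (p t, t).
  move: xt; rewrite !inE => /orP[/eqP//|/eqP xt].
  have := endpoint_le_fst (tin _ (mem_head _ _)).
  by rewrite xt /= leqNgt pq.
have u0 : 0 < u by move: tu; case: (u) => //; rewrite addn0; case: ltngtP.
case: u u0 pq pm pE xminE tu tin => // u _ pq pm pE xminE tu tin.
have tE : t = nx.
  apply/eqP; rewrite eqn_leq andbC; case/andP: (tu) => -> _ /=.
  have : endpoint_le x (p nx, nx).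
    by apply: xminE; rewrite mem_cat /= inE eqxx orbT.
  rewrite xt /endpoint_le /= => /orP[|/andP[]//].
  by rewrite ltnNge pm.
rewrite xt tE /= mem_cat; apply/orP; left; apply/map_f; apply: IH => //.
- by move=> s /andP[/ltnW a b]; apply: pq; rewrite a addnS -addSn b.
- by move=> s z a b; apply: pm; [exact: ltnW | rewrite addnS -addSn].
rewrite -(perm_cons x); apply: perm_trans pE _; rewrite xt tE /=.
apply/permP => a; rewrite !(count_cat, count_map) /= !count_cat addnCA.
by rewrite [count _ _ + (_ + _)]addnCA !count_map.
Qed.
End Words.

(** Consecutive differences of a, the positions in s and n. *)
Fixpoint gaps_from (n a : nat) (s : seq nat) : seq nat :=
  if s is y :: s' then (y - a) :: gaps_from n y s' else [:: n - a].

Lemma size_gaps_from n a s : size (gaps_from n a s) = (size s).+1.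
Proof. by elim: s a => //= y s IH a; rewrite IH. Qed.

Lemma sumn_gaps_from n a s : path leq a s -> last a s <= n -> sumn (gaps_from n a s) = n - a.
Proof.
elim: s a => [|y s IH] a /=; first by rewrite addn0.
move=> /andP[ay ys] ln; rewrite IH // addnBAC // subnKC //.
have := ln; rewrite leqNgt; apply: contraR; rewrite -ltnNge => ny.
apply: leq_trans ny _.
elim: s y ys {IH ln ay} => //= z s IH y /andP[yz /IH]; exact: leq_trans.
Qed.

(** The values of F on the nonempty prefixes of w. *)
Fixpoint prefix_vec (F : seq nat -> bool) (w : seq nat) : seq bool :=
  if w is t :: w' then F [:: t] :: prefix_vec (fun u => F (t :: u)) w' else [::].

(** A function of the endpoints met so far is constant on each gap. *)
Lemma dot_prefix_vec F n x E :
  path leq x.1 (map fst E) -> last x.1 (map fst E) <= n ->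
  dot (prefix_vec F (map snd (x :: E))) (gaps_from n x.1 (map fst E)) =
  \sum_(x.1 <= i < n) F [seq y.2 | y <- x :: E & y.1 <= i].
Proof.
elim: E F x => [|y E IH] F x.
  move=> _ xn; rewrite [LHS]/= addn0 [RHS](eq_big_nat _ _ (F2 := fun=> F [:: x.2] : nat)).
    by rewrite sum_nat_const_nat; case: (F _); rewrite ?muln1 ?muln0.
  by move=> i /andP[xi _] /=; rewrite xi.
move=> /= /andP[xy yE] ln.
have yn : y.1 <= n.
  have := ln; rewrite leqNgt; apply: contraR; rewrite -ltnNge => ny.
  apply: leq_trans ny _.
  elim: (map _ _) (y.1) yE => //= z s IHs a /andP[yz /IHs]; exact: leq_trans.
rewrite (big_cat_nat xy yn) /=; congr (_ + _).
  rewrite [RHS](eq_big_nat _ _ (F2 := fun=> F [:: x.2] : nat)).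
    by rewrite sum_nat_const_nat; case: (F _); rewrite ?muln1 ?muln0.
  move=> i /andP[xi iy] /=; rewrite xi leqNgt iy /=.
  have -> : [seq y <- E | y.1 <= i] = [::]; last by [].
  rewrite -(filter_pred0 E); apply: eq_in_filter => z zE /=; apply/negbTE.
  rewrite -ltnNge (leq_trans iy) //.
  by have := order_path_min leq_trans yE => /allP; apply; apply: map_f.
apply: etrans (IH (fun u => F (x.2 :: u)) y yE ln) _; apply: eq_big_nat => i /andP[yi _] /=.
by rewrite (leq_trans xy yi).
Qed.

Definition parity (sg : seq bool) (u : seq nat) : bool :=
  \big[addb/false]_(t <- u) nth false sg t.

Lemma eq_prefix_vec F G w : F =1 G -> prefix_vec F w = prefix_vec G w.
Proof.
elim: w F G => //= t w IH F G FG; rewrite FG; congr (_ :: _).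
by apply: IH => u; apply: FG.
Qed.

Lemma side_vecE sg w e : side_vec sg w e = prefix_vec (fun u => e (+) parity sg u) w.
Proof.
elim: w e => //= t w IH e; rewrite IH /parity big_seq1; congr (_ :: _).
by apply: eq_prefix_vec => u; rewrite big_cons addbA.
Qed.

Lemma mask_diff_prefix_vec F G w :
  mask_diff (prefix_vec F w) (prefix_vec G w) = prefix_vec (fun u => F u && ~~ G u) w.
Proof. by elim: w F G => //= t w IH F G; rewrite IH. Qed.

(** Whether the Hamiltonian edge from i to i + 1 belongs to the even set with
    chords sg and side e, when chord t joins the positions p t and q t. *)
Definition level (k : nat) (p q : nat -> nat) (sg : seq bool) (e : bool) (i : nat) : bool :=
  e (+) \big[addb/false]_(t < k) (nth false sg t && ((p t <= i) (+) (q t <= i))).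

(** The hypothesis gap_le expresses that the last gap is the largest, in terms
    of arbitrary intervals free of endpoints. *)
Section Arrangement.
Variables (k n M : nat) (p q : nat -> nat).
Hypotheses (k_gt0 : 0 < k) (ltpq : forall t, t < k -> p t < q t)
  (leqM : forall t, t < k -> q t <= M) (ltMn : M < n)
  (p_mono : forall s t, s <= t < k -> p s <= p t) (p0 : p 0 = 0)
  (gap_le : forall a b, a < b < n ->
     (forall t, t < k -> ((p t <= a) || (b <= p t)) && ((q t <= a) || (b <= q t))) ->
     b - a <= n - M).

Let E0 := flatten [seq [:: (p t, t); (q t, t)] | t <- iota 0 k].
Let E := sort endpoint_le E0.

Let memE x : x \in E -> exists2 t, t < k & (x = (p t, t)) \/ (x = (q t, t)).
Proof.
rewrite mem_sort => /flattenP[s /mapP[t]]; rewrite mem_iota => tk ->.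
by rewrite !inE => /orP[]/eqP->; exists t; auto.
Qed.

Let E_mem t : t < k -> (p t, t) \in E /\ (q t, t) \in E.
Proof.
move=> tk; rewrite !mem_sort; split; apply/flattenP;
  (exists [:: (p t, t); (q t, t)]; last by rewrite !inE eqxx ?orbT);
  by apply/mapP; exists t; rewrite ?mem_iota.
Qed.

Let E_uniq : uniq E.
Proof.
rewrite sort_uniq /E0; have : forall t, t \in iota 0 k -> p t < q t.
  by move=> t; rewrite mem_iota; apply: ltpq.
elim: (iota 0 k) (iota_uniq 0 k) => //= t s IH /andP[ts us] H.
rewrite IH ?andbT // => [|u us']; last by apply: H; rewrite inE us' orbT.
have tn x : x.2 = t -> x \notin flatten [seq [:: (p t, t); (q t, t)] | t <- s].
  move=> xt; apply/flattenP => -[r /mapP[u us' ->]].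
  by rewrite !inE => /orP[]/eqP xE; move: ts; rewrite -xt xE us'.
by rewrite inE negb_or !tn // xpair_eqE eqxx andbT ltn_eqF // H // mem_head.
Qed.

Let E_sorted : sorted endpoint_le E.
Proof. exact: sort_sorted endpoint_le_total _. Qed.

Let size_E : size E = k.*2.
Proof.
rewrite size_sort /E0; elim: k 0 => //= k' IH t.
by rewrite IH.
Qed.

(** A chord both of whose ends have been met contributes twice, that is not at
    all, to the parity. *)
Lemma levelE sg e i :
  level k p q sg e i = e (+) parity sg [seq y.2 | y <- E & y.1 <= i].
Proof.
rewrite /level /parity big_map big_filter (perm_big E0); last first.
  by rewrite perm_sort.
rewrite /E0; have -> : iota 0 k = index_iota 0 k by rewrite /index_iota subn0.
rewrite big_flatten big_map big_mkord; congr (_ (+) _); apply: eq_bigr => t _.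
rewrite !big_cons big_nil /=.
by case: (p t <= i); case: (q t <= i); rewrite ?andbF ?andbT ?addbF ?addbb.
Qed.

Let E_consE : exists x E', E = x :: E' /\ x.1 = 0.
Proof.
have [pE _] := E_mem k_gt0; case defE: E pE => [//|x E'] _; exists x, E'; split=> //.
have [pE _] := E_mem k_gt0; have := E_sorted; rewrite defE /=.
rewrite (path_sortedE endpoint_le_trans) => /andP[/allP xmin _].
apply/eqP; rewrite -leqn0 -p0; move: pE; rewrite defE inE => /orP[/eqP <- //|/xmin].
by move/endpoint_le_fst.
Qed.

Let word := map snd E.
Let gaps := gaps_from n 0 (behead (map fst E)).

Let path_E x E' : E = x :: E' -> path leq x.1 (map fst E').
Proof.
have := E_sorted => /[swap] -> /=.
by rewrite path_map; apply: sub_path => y z; apply: endpoint_le_fst.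
Qed.

Let last_E x E' : E = x :: E' -> last x.1 (map fst E') <= M.
Proof.
move=> defE; have : last x E' \in E by rewrite defE mem_last.
rewrite last_map => /memE[t tk [] ->] /=; last exact: leqM.
exact: leq_trans (ltnW (ltpq tk)) (leqM tk).
Qed.

Lemma word_mem : word \in chord_words k.
Proof.
rewrite /chord_words -size_E; apply: (@word_in_words_from p q) => //.
- by move=> s t _ /andP[st tk]; apply: p_mono; rewrite st.
- by rewrite perm_sort.
Qed.

Lemma size_word : size word = k.*2.
Proof. by rewrite size_map. Qed.

Lemma size_gaps : size gaps = k.*2.
Proof.
have [x [E' [defE _]]] := E_consE.
by rewrite /gaps size_gaps_from size_behead size_map -size_E defE.
Qed.

Lemma sumn_gaps : sumn gaps = n.
Proof.
have [x [E' [defE x0]]] := E_consE.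
rewrite /gaps defE /= -x0 sumn_gaps_from ?path_E //; first by rewrite x0 subn0.
exact: leq_trans (last_E defE) (ltnW ltMn).
Qed.

(** Two consecutive endpoints at the same position belong to different chords,
    and the sort puts the smaller number first. *)
Lemma gaps_respect : respects (nonzero_gaps word) gaps.
Proof.
have [x [E' [defE x0]]] := E_consE.
rewrite /word /gaps; move: E_sorted E_uniq; rewrite defE /= -x0.
elim: E' x {defE x0} => [|y E' IH] x //= /andP[xy yE] /andP[xnE yu].
rewrite -/(respects _ _) IH // andbT; apply/implyP => yx.
move: xy; rewrite /endpoint_le subn_eq0 -ltnNge => /orP[//|/andP[/eqP x1 x2]].
have x2y : x.2 = y.2 by apply/eqP; rewrite eqn_leq x2.
by move: xnE; rewrite inE [x]surjective_pairing [y]surjective_pairing x1 x2y eqxx.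
Qed.

Lemma gaps_max : all (leq^~ (last 0 gaps)) gaps.
Proof.
have [x [E' [defE x0]]] := E_consE.
have lastM d y (E1 : seq (nat * nat)) : last y (map fst E1) <= M ->
    n - M <= last d (gaps_from n y (map fst E1)).
  by elim: E1 d y => [|z E1 IH] d y /=; [apply: leq_sub2l | apply: IH].
(* By induction along E; pre keeps the endpoints already passed. *)
have sub pre d y E1 : E = pre ++ y :: E1 ->
    all (leq^~ (last d (gaps_from n y.1 (map fst E1)))) (gaps_from n y.1 (map fst E1)).
  elim: E1 pre d y => [|z E1 IH] pre d y preE /=; first by rewrite leqnn.
  have zE : E = (pre ++ [:: y]) ++ z :: E1 by rewrite -catA.
  rewrite (IH _ _ _ zE) andbT.
  have lE : last z.1 (map fst E1) <= M.
    have := last_E defE; rewrite last_map; have := congr1 (last x) zE.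
    by rewrite {1}defE /= !last_cat /= last_map => ->.
  apply: leq_trans (lastM _ _ _ lE); have [yz|] := ltnP y.1 z.1; last first.
    by rewrite -subn_eq0 => /eqP->.
  have zM : z.1 <= M.
    by have : z \in E; [rewrite zE !mem_cat mem_head !orbT | case/memE=> t tk [] -> /=;
       [apply: leq_trans (ltnW (ltpq tk)) (leqM tk) | apply: leqM]].
  apply: gap_le => [|t tk]; first by rewrite yz (leq_ltn_trans zM).
  have cut e : e \in E -> (e.1 <= y.1) || (z.1 <= e.1).
    rewrite preE mem_cat inE => eE.
    have := E_sorted; rewrite preE (sorted_pairwise endpoint_le_trans) pairwise_cat.
    rewrite allrel_consr => /and3P[/andP[/allP pre_y _] _ /= /and3P[_ /allP z_min _]].
    case/or3P: eE => [/pre_y/endpoint_le_fst ->//|/eqP->|]; first by rewrite leqnn.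
    by rewrite inE => /orP[/eqP->|/z_min/endpoint_le_fst->]; rewrite ?leqnn orbT.
  by have [/cut -> /cut] := E_mem tk.
by rewrite /gaps defE /= -x0; apply: (sub [::]).
Qed.

Lemma dot_level F :
  dot (prefix_vec F word) gaps = \sum_(i < n) F [seq y.2 | y <- E & y.1 <= i].
Proof.
have [x [E' [defE x0]]] := E_consE.
rewrite /word /gaps defE -[behead _]/(map fst E') -x0 dot_prefix_vec ?path_E //; last first.
  exact: leq_trans (last_E defE) (ltnW ltMn).
by rewrite x0 big_mkord.
Qed.

(** The passage from positions on a Hamiltonian cycle to words and gaps: sums
    over edges become sums of gaps, and an edge that separates two even sets
    lies in a nonempty gap that separates them. *)
Lemma arrangement_search ns : n \in ns ->
  (forall l, 3 <= l < n -> exists sg e, let lev := level k p q in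
    [/\ size sg = k, has id sg, l = count id sg + \sum_(i < n) lev sg e i &
    forall t e', size t = k -> has id t -> mask_sub t sg -> ~~ mask_sub sg t ->
      exists i : 'I_n, lev t e' i && ~~ lev sg e i]) ->
  pancyclic_candidate k ns.
Proof.
move=> nns att; apply: (pancyclic_candidate_sound nns word_mem size_word size_gaps
  sumn_gaps gaps_respect gaps_max) => l /att[sg [e [sz nz -> sep]]].
exists sg, e; split=> // [|t e' tz tn ts st].
  rewrite side_vecE dot_level; congr (_ + _); apply: eq_bigr => i _.
  by rewrite levelE.
rewrite !side_vecE mask_diff_prefix_vec dot_level.
have [i /andP[ti si]] := sep t e' tz tn ts st.
by rewrite (bigD1 i) //= -!levelE ti si.
Qed.
End Arrangement.

(** * Cycles as minimal even edge sets *)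

Section GraphCycles.
Variables (T : finType) (G : sgraph T).

(** A cycle parametrized by the cyclic order of 'I_l. *)
Definition graph_cycle (l : nat) (c : 'I_l -> T) : Prop :=
  injective c /\ forall i, adj G (c i) (c (ordS i)).

Definition cycle_edge (l : nat) (c : 'I_l -> T) (i : 'I_l) : {set T} :=
  [set c i; c (ordS i)].

Definition cycle_edges (l : nat) (c : 'I_l -> T) : {set {set T}} :=
  [set cycle_edge c i | i : 'I_l].

Definition even_set (X : {set {set T}}) : Prop :=
  forall v, \big[addb/false]_(e in X) (v \in e) = false.

Lemma cycle_nth (e : rel T) x s i :
  cycle e s -> i < size s -> e (nth x s i) (nth x s (i.+1 %% size s)).
Proof.
case: s => //= y s /(pathP x); rewrite size_rcons => H i_s.
have := H i i_s; rewrite -rcons_cons nth_rcons i_s nth_rcons.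
move: i_s; rewrite ltnS leq_eqVlt => /orP[/eqP->|i_s].
  by rewrite ltnn eqxx modnn.
by rewrite i_s modn_small.
Qed.

Lemma has_cycle_graph_cycle l : has_cycle G l -> 3 <= l /\ exists c : 'I_l -> T, graph_cycle c.
Proof.
case/andP=> l3 /existsP[c /andP[cc uc]]; split=> //; exists (tnth c); split.
  exact/tuple_uniqP.
move=> i; have := cycle_nth (tnth c i) cc (i := i); rewrite size_tuple => /(_ (ltn_ord i)).
by rewrite -(tnth_nth _ c i) -(tnth_nth _ c (ordS i)).
Qed.

Lemma ordS_const l (f : 'I_l -> bool) : (forall i, f (ordS i) = f i) -> forall i j, f i = f j.
Proof.
move=> fS; case: l f fS => [f _ []//|l f fS].
suff f0 i : f i = f ord0 by move=> i j; rewrite !f0.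
case: i => m; elim: m => [|m IH] ml; first by congr f; apply: val_inj.
rewrite -(IH (ltnW ml)) -[RHS]fS; congr f; apply: val_inj => /=.
by rewrite modn_small.
Qed.

Lemma ordSE l (i : 'I_l) : ordS i = (if i.+1 < l then i.+1 else 0) :> nat.
Proof.
rewrite /=; case: ltnP => [/modn_small//|li].
by have -> : i.+1 = l by [apply/eqP; rewrite eqn_leq ltn_ord]; rewrite modnn.
Qed.

Lemma ordS_neq l (i : 'I_l) : 1 < l -> ordS i != i.
Proof.
move=> l1; apply/eqP => /(congr1 val); rewrite [LHS]ordSE /=.
case: ltnP => [_ /eqP|li i0]; first by rewrite gtn_eqF.
by move: li; rewrite -i0 leqNgt l1.
Qed.

Lemma ordS2_neq l (i : 'I_l) : 2 < l -> ordS (ordS i) != i.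
Proof.
move=> l2; apply/eqP => /(congr1 val); rewrite [LHS]ordSE ordSE.
have := ltn_ord i; case: (ltnP i.+1 l) => il _.
  case: ltnP => [_ /eqP|li i0]; first by rewrite gtn_eqF // ltnW.
  by move: li; rewrite -i0 leqNgt l2.
rewrite (ltnW l2) => i1; by move: il; rewrite -i1 leqNgt l2.
Qed.

Lemma addb_pick l (P : pred 'I_l) j : \big[addb/false]_(i | P i) (i == j) = P j.
Proof.
rewrite big_mkcond (bigD1 j) //= eqxx big1 ?addbF; first by case: (P j).
by move=> i /negPf ->; case: ifP.
Qed.

Section OneCycle.
Variables (l : nat) (c : 'I_l -> T).
Hypotheses (l3 : 3 <= l) (cG : graph_cycle c).

Lemma mem_cycle_edge i j : (c j \in cycle_edge c i) = (i == j) (+) (i == ord_pred j).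
Proof.
have [ci _] := cG; rewrite in_set2 !(inj_eq ci) [j == i]eq_sym.
rewrite -(can2_eq (@ordSK l) (@ord_predK l)) [j == _]eq_sym.
case: eqP => [->|//]; rewrite (negPf (ordS_neq _ _)) //; exact: ltnW.
Qed.

(** This is where l is at least 3: two edges with the same ends would give
    i + 2 = i modulo l. *)
Lemma cycle_edge_inj : injective (cycle_edge c).
Proof.
move=> i j /setP eij; apply: contraTeq (ordS2_neq i l3) => nij.
have l1 : 1 < l by apply: ltnW.
have /eqP jS : j == ordS i.
  have := eij (c (ordS i)); rewrite !mem_cycle_edge !ordSK eqxx [j == i]eq_sym.
  by rewrite (negPf nij) [i == _]eq_sym (negPf (ordS_neq i l1)) addbF => <-.
have : j == ord_pred i.
  have := eij (c i); rewrite !mem_cycle_edge eqxx [j == i]eq_sym (negPf nij).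
  rewrite -[i == ord_pred i](can2_eq (@ordSK l) (@ord_predK l)).
  by rewrite (negPf (ordS_neq i l1)) addFb => <-.
by rewrite jS => /eqP->; rewrite ord_predK negbK.
Qed.

Lemma card_cycle_edges : #|cycle_edges c| = l.
Proof. by rewrite card_imset ?card_ord //; exact: cycle_edge_inj. Qed.

Lemma cycle_edges_sub : cycle_edges c \subset edges G.
Proof. by apply/subsetP => e /imsetP[i _ ->]; apply: cG.2. Qed.

Lemma parity_cycle_edge (P : pred 'I_l) j :
  \big[addb/false]_(i | P i) (c j \in cycle_edge c i) = P j (+) P (ord_pred j).
Proof.
rewrite (eq_bigr _ (fun i _ => mem_cycle_edge i j)) big_split /=.
by rewrite !addb_pick.
Qed.

(** A vertex of the cycle lies on exactly two of its edges. *)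
Lemma parity_sub_cycle (Y : {set {set T}}) j : Y \subset cycle_edges c ->
  \big[addb/false]_(e in Y) (c j \in e) =
  (cycle_edge c j \in Y) (+) (cycle_edge c (ord_pred j) \in Y).
Proof.
move=> Yc; rewrite -(parity_cycle_edge (fun i => cycle_edge c i \in Y)).
have -> : Y = [set cycle_edge c i | i in [set i | cycle_edge c i \in Y]].
  apply/setP => e; apply/idP/imsetP => [eY|[i]]; last by rewrite inE => iY ->.
  have /imsetP[i _ ei] := subsetP Yc e eY.
  by exists i; rewrite // inE -ei.
rewrite big_imset /=; last by move=> i j' _ _; apply: cycle_edge_inj.
by apply: eq_bigl => i; rewrite inE mem_imset ?inE //; apply: cycle_edge_inj.
Qed.

Lemma cycle_edges_even_set : even_set (cycle_edges c).
Proof.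
move=> v; have [/existsP[j /eqP->]|nv] := boolP [exists j, v == c j].
  by rewrite parity_sub_cycle // /cycle_edges !imset_f.
rewrite big1 // => e /imsetP[i _ ->]; apply/negbTE; apply: contra nv.
by rewrite in_set2 => /orP[]/eqP->; apply/existsP; [exists i|exists (ordS i)].
Qed.

(** At each vertex of the cycle, Y contains both of the two edges or neither;
    going around, all of them or none. *)
Lemma cycle_edges_minimal (Y : {set {set T}}) :
  Y \subset cycle_edges c -> even_set Y -> Y != set0 -> Y = cycle_edges c.
Proof.
move=> Yc Ye /set0Pn[e eY]; apply/eqP; rewrite eqEsubset Yc.
apply/subsetP => _ /imsetP[j _ ->]; have /imsetP[i _ ei] := subsetP Yc e eY.
rewrite ei in eY.
rewrite (@ordS_const l (fun i => cycle_edge c i \in Y) _ j i) // => {}j.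
by have := Ye (c (ordS j)); rewrite parity_sub_cycle // ordSK; do 2 case: (_ \in Y).
Qed.
End OneCycle.
End GraphCycles.

(** * Cycles relative to a Hamiltonian cycle *)

(** The graph is described by the positions of its vertices on the Hamiltonian
    cycle s. *)
Section Hamilton.
Variables (T : finType) (G : sgraph T) (n : nat) (s : 'I_n -> T).
Hypotheses (n3 : 3 <= n) (cardT : #|T| = n) (sG : graph_cycle G s).

Let ham := cycle_edges s.
Definition chords : {set {set T}} := edges G :\: cycle_edges s.
Let k := #|chords|.

Lemma card_edges_chords : #|edges G| = n + k.
Proof.
rewrite -(cardsID ham); congr (_ + _); rewrite (setIidPr (cycle_edges_sub sG)).
exact: card_cycle_edges sG.
Qed.

Let s_onto v : exists i, v = s i.
Proof.
have [g _ gs] : bijective s by apply: inj_card_bij sG.1 _; rewrite card_ord cardT.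
by exists (g v); rewrite gs.
Qed.

Definition ends (e : {set T}) : nat * nat :=
  if [pick x : 'I_n * 'I_n | (x.1 < x.2) && (e == [set s x.1; s x.2])] is Some x
  then (val x.1, val x.2) else (0, 0).

Lemma endsP e : e \in chords -> [/\ (ends e).1 < (ends e).2, (ends e).2 < n &
  forall i, (s i \in e) = (i == (ends e).1 :> nat) (+) (i == (ends e).2 :> nat)].
Proof.
rewrite inE => /andP[_ eG]; rewrite /ends; case: pickP => [[i j] /= /andP[ij /eqP->]|H].
  split=> // x; rewrite in_set2 !(inj_eq sG.1) -!val_eqE /=.
  by case: eqP => // ->; rewrite (ltn_eqF ij).
have /cards2P[x [y [xy eE]]] := forall_inP (edges_pairs G) e eG.
have [i xi] := s_onto x; have [j yj] := s_onto y; subst x y.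
have [ij|ji|/val_inj ij] := ltngtP i j.
- by have := H (i, j); rewrite /= ij eE eqxx.
- by have := H (j, i); rewrite /= ji eE setUC eqxx.
- by rewrite ij eqxx in xy.
Qed.

Definition chord_seq : seq {set T} :=
  sort (fun e f => (ends e).1 <= (ends f).1) (enum chords).

Definition left_end (t : nat) : nat := (ends (nth set0 chord_seq t)).1.
Definition right_end (t : nat) : nat := (ends (nth set0 chord_seq t)).2.

Let L := chord_seq.
Let p := left_end.
Let q := right_end.

Let size_L : size L = k.
Proof. by rewrite size_sort -cardE. Qed.

Let memL e : (e \in L) = (e \in chords).
Proof. by rewrite mem_sort mem_enum. Qed.

Let L_uniq : uniq L.
Proof. by rewrite sort_uniq enum_uniq. Qed.

Let L_nth t : t < k -> nth set0 L t \in chords.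
Proof. by move=> tk; rewrite -memL mem_nth // size_L. Qed.

Lemma left_lt_right t : t < #|chords| -> left_end t < right_end t.
Proof. by move/L_nth/endsP => []. Qed.

Lemma right_lt t : t < #|chords| -> right_end t < n.
Proof. by move/L_nth/endsP => []. Qed.

Lemma left_end_mono t u : t <= u < #|chords| -> left_end t <= left_end u.
Proof.
move=> /andP[tu uk].
have := @sorted_leq_nth _ (fun e f => (ends e).1 <= (ends f).1) _ _ set0 L.
apply=> //; rewrite ?inE ?size_L //; last exact: leq_ltn_trans uk.
- by move=> x y z; apply: leq_trans.
- by apply: sort_sorted => x y; apply: leq_total.
Qed.

Lemma chord_end_pos (i : 'I_n) :
  reflect (exists2 t, t < #|chords| & (i == left_end t :> nat) || (i == right_end t :> nat))
          [exists e in chords, s i \in e].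
Proof.
apply: (iffP exists_inP) => [[e eD]|[t tk it]].
  have [_ _ ->] := endsP eD; rewrite -memL in eD => ie.
  exists (index e L); first by rewrite -/k -size_L index_mem.
  by rewrite /left_end /right_end nth_index //; move: ie; do 2 case: eqP.
exists (nth set0 L t); first exact: L_nth.
have [lt _ ->] := endsP (L_nth tk); case/orP: it => /eqP->; rewrite eqxx.
  by rewrite (ltn_eqF lt).
by rewrite (gtn_eqF lt).
Qed.

(** Parity at v of the set of chords selected by sg. *)
Definition chord_parity (sg : seq bool) (v : T) : bool :=
  \big[addb/false]_(t < k) (nth false sg t && (v \in nth set0 L t)).

(** The last term corrects the wrap-around at 0; it cancels out in [level_step],
    each chord having two ends. *)
Let leq_ord_pred a (i : 'I_n) : a < n ->
  (a <= i) = (a <= ord_pred i) (+) (i == a :> nat) (+) (i == 0 :> nat).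
Proof.
move=> an; rewrite -{1 3 4}[i]ord_predK; move: (ord_pred i) => j; rewrite !ordSE.
case: ltnP => [jn|nj].
  rewrite /= addbF leq_eqVlt ltnS [a == _]eq_sym.
  by case: (j.+1 =P a) => [<-|_] /=; rewrite ?ltnn ?addbF.
have -> : a <= j by rewrite -ltnS (leq_trans an).
by rewrite leqn0 eq_sym; case: eqP.
Qed.

(** Passing an endpoint of a selected chord switches the side. *)
Lemma level_step sg e (i : 'I_n) :
  let lev := level #|chords| left_end right_end in
  lev sg e i = lev sg e (ord_pred i) (+) chord_parity sg (s i).
Proof.
rewrite /= /level /chord_parity -addbA -big_split; congr (_ (+) _).
apply: eq_bigr => t _ /=; case: (nth false sg t) => //=.
have [_ _ ->] := endsP (L_nth (ltn_ord t)).
have qn : q t < n := right_lt (ltn_ord t).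
have pn : p t < n := ltn_trans (left_lt_right (ltn_ord t)) qn.
rewrite (leq_ord_pred i pn) (leq_ord_pred i qn) -/(p t) -/(q t).
by do 5 case: (_ == _) || case: (_ <= _).
Qed.

(** Solutions of the parity condition for a given set of chords differ by a
    constant, hence there are two of them. *)
Let level_const sg (h : 'I_n -> bool) :
  (forall i, h i = h (ord_pred i) (+) chord_parity sg (s i)) ->
  exists e, forall i, h i = level k p q sg e i.
Proof.
move=> hS; pose i0 := Ordinal (ltn_trans (isT : 0 < 2) n3).
have f_const := @ordS_const n (fun i => h i (+) level k p q sg false i).
exists (h i0 (+) level k p q sg false i0) => i.
rewrite -(f_const _ i i0) => [|j].
  by rewrite /level addFb addbK.
rewrite hS level_step ordSK; by case: (h j); case: (level _ _ _ _ _ _); case: (chord_parity _ _).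
Qed.

Let chord_parityE (X : {set {set T}}) v : X \subset edges G ->
  \big[addb/false]_(e in X :\: ham) (v \in e) = chord_parity [seq e \in X | e <- L] v.
Proof.
move=> XG; transitivity (\big[addb/false]_(e <- L) ((e \in X) && (v \in e))).
  rewrite [RHS](big_uniq _ L_uniq) /= big_mkcond [RHS]big_mkcond; apply: eq_bigr => e _.
  rewrite memL !inE; case eX: (e \in X); last by rewrite andbF if_same.
  by rewrite (subsetP XG) // !andbT.
rewrite (big_nth set0) big_mkord size_L; apply: eq_bigr => t _.
by rewrite (nth_map set0) // size_L.
Qed.

(** The parity condition at the vertex s i, in the form of a recurrence between
    the two Hamiltonian edges at this vertex. *)
Let even_set_iff (X : {set {set T}}) : X \subset edges G ->
  even_set X <-> forall i, (cycle_edge s i \in X) =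
    (cycle_edge s (ord_pred i) \in X) (+) chord_parity [seq e \in X | e <- L] (s i).
Proof.
move=> XG; have par i : \big[addb/false]_(e in X) (s i \in e) =
    (cycle_edge s i \in X) (+) (cycle_edge s (ord_pred i) \in X)
      (+) chord_parity [seq e \in X | e <- L] (s i).
  rewrite (big_setID ham) /= chord_parityE //; congr (_ (+) _).
  by rewrite (parity_sub_cycle n3 sG) ?subsetIr // !inE /ham /cycle_edges !imset_f // !andbT.
split=> [Xe i|H v].
  have := Xe (s i); rewrite par.
  by case: (_ \in X); case: (_ \in X); case: (chord_parity _ _).
have [i ->] := s_onto v; rewrite par H.
by case: (_ \in X); case: (chord_parity _ _).
Qed.

(** A cycle shorter than n contains a chord, as otherwise it would be a proper
    even part of the Hamiltonian cycle.  If every Hamiltonian edge of the even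
    set (t, e') were in the cycle, this even set would be a proper nonempty part
    of the cycle, against minimality. *)
Lemma cycle_attains l : 3 <= l < n -> has_cycle G l ->
  exists sg e, let lev := level #|chords| left_end right_end in
    [/\ size sg = #|chords|, has id sg, l = count id sg + \sum_(i < n) lev sg e i &
    forall t e', size t = #|chords| -> has id t -> mask_sub t sg -> ~~ mask_sub sg t ->
      exists i : 'I_n, lev t e' i && ~~ lev sg e i].
Proof.
move=> /andP[l3 ln] /has_cycle_graph_cycle[_ [c cG]].
pose X := cycle_edges c; pose sg := [seq e \in X | e <- L].
have XG : X \subset edges G := cycle_edges_sub cG.
have Xe : even_set X := cycle_edges_even_set l3 cG.
have Xmin := cycle_edges_minimal l3 cG.
have cX : #|X| = l := card_cycle_edges l3 cG.
have [e eE] := level_const ((even_set_iff XG).1 Xe).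
have sz_sg : size sg = k by rewrite size_map.
have cnt : count id sg = #|X :\: ham|.
  rewrite count_map -size_filter cardE; apply: perm_size.
  apply: uniq_perm => [||f]; [exact: filter_uniq | exact: enum_uniq |].
  rewrite mem_filter memL mem_enum !inE /= andbCA; case fX: (f \in X); rewrite ?andbF //=.
  by rewrite (subsetP XG) // !andbT.
exists sg, e; split=> //.
- rewrite has_count cnt card_gt0; apply: contraTneq ln => X0.
  have Xham : X \subset ham by rewrite -setD_eq0 X0.
  have := cycle_edges_minimal n3 sG Xham Xe; rewrite -card_gt0 cX.
  move=> /(_ (ltn_trans (isT : 0 < 2) l3)) XE.
  by rewrite -cX XE (card_cycle_edges n3 sG) ltnn.
- rewrite -cX -(cardsID ham X) cnt addnC; congr (_ + _).
  rewrite (eq_bigr (fun i => (cycle_edge s i \in X) : nat)); last by move=> i _; rewrite eE.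
  have -> : X :&: ham = [set cycle_edge s i | i in [set i | cycle_edge s i \in X]].
    apply/setP => f; rewrite inE; apply/andP/imsetP => [[fX /imsetP[i _ fE]]|[i]].
      by exists i => //; rewrite inE -fE.
    by rewrite inE => iX ->; split=> //; apply: imset_f.
  rewrite card_imset; last exact: cycle_edge_inj sG.
  by rewrite -sum1dep_card big_mkcond; apply: eq_bigr => i _; case: (_ \in X).
move=> t e' tz tn t_sg sg_t; apply/existsP; apply: contraNT sg_t.
rewrite negb_exists => /forallP sub.
have {}sub (i : 'I_n) : level k p q t e' i -> cycle_edge s i \in X.
  by move=> ti; have := sub i; rewrite ti negbK -eE.
(* Y is the even set given by t and e'. *)
pose Y := [set f in L | nth false t (index f L)] :|:
          [set cycle_edge s i | i in [set i : 'I_n | level k p q t e' i]].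
have nham f : f \in L -> f \in ham = false by rewrite memL inE => /andP[/negPf].
have YL f : f \in L -> (f \in Y) = nth false t (index f L).
  move=> fL; rewrite !inE fL /=; case: nth => //=; apply/negbTE/negP => /imsetP[i _ fE].
  by have := nham _ fL; rewrite fE imset_f.
have Yham i : (cycle_edge s i \in Y) = level k p q t e' i.
  rewrite !inE; case: (boolP (cycle_edge s i \in L)) => [/nham|_] /=; first by rewrite imset_f.
  by rewrite mem_imset ?inE //; exact: cycle_edge_inj sG.
have mask_subP u v : mask_sub u v -> size u = size v -> forall i, nth false u i -> nth false v i.
  elim: u v => [|a u IH] [|b v] //= /andP[/implyP ab uv] [sz] [|i] //=; exact: IH.
have YX : Y \subset X.
  apply/subsetP => f; rewrite !inE => /orP[/andP[fL ft]|/imsetP[i]]; last first.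
    by rewrite inE => /sub iX ->.
  have := mask_subP _ _ t_sg _ _ ft; rewrite tz sz_sg => /(_ erefl).
  by rewrite (nth_map set0) ?index_mem // nth_index.
have Yt : [seq f \in Y | f <- L] = t.
  apply: (@eq_from_nth _ false) => [|i]; rewrite size_map size_L ?tz // => ik.
  by rewrite (nth_map set0) ?size_L // YL ?mem_nth ?size_L // index_uniq // size_L.
have Yev : even_set Y.
  apply/(even_set_iff (subset_trans YX XG)) => i; rewrite !Yham Yt; exact: level_step.
have Y0 : Y != set0.
  have [i it ti] : exists2 i, i < k & nth false t i.
    by move/(has_nthP false): tn => [i]; rewrite tz; exists i.
  apply/set0Pn; exists (nth set0 L i); rewrite YL ?mem_nth ?size_L //.
  by rewrite index_uniq // size_L.
rewrite /sg /X -(Xmin Y YX Yev Y0) Yt.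
by elim: (t) => //= a u ->; rewrite implybb.
Qed.
End Hamilton.

(** * Choosing the starting point of the Hamiltonian cycle *)

Section Rotation.
Variables (T : finType) (G : sgraph T) (n : nat).

Definition rotate (s : 'I_n -> T) (r : nat) (i : 'I_n) : T := s (iter r (@ordS n) i).

Lemma val_iter_ordS r (i : 'I_n) : iter r (@ordS n) i = (i + r) %% n :> nat.
Proof.
elim: r => [|r IH]; first by rewrite addn0 modn_small.
by rewrite iterS /= IH -addn1 modnDml addn1 addnS.
Qed.

Lemma rotate_cycle s r : graph_cycle G s -> graph_cycle G (rotate s r).
Proof.
move=> [sI sA]; split=> [i j /sI|i]; last by rewrite /rotate -iterSr iterS.
by elim: r => //= r IH /(can_inj (@ordSK n)).
Qed.

Lemma rotate_edges s r : 3 <= n -> graph_cycle G s -> cycle_edges (rotate s r) = cycle_edges s.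
Proof.
move=> n3 sG; apply/eqP; rewrite eqEcard !(@card_cycle_edges _ G) //; last exact: rotate_cycle.
rewrite leqnn andbT; apply/subsetP => _ /imsetP[i _ ->].
rewrite /cycle_edge /rotate -iterSr iterS; exact: imset_f.
Qed.

(** All the chord endpoints are among the positions 0 to M. *)
Definition chords_within (s : 'I_n -> T) (M : nat) : bool :=
  [forall i, [exists e in chords G s, s i \in e] ==> (i <= M)].

(** Positions beyond M form the last gap, so making M least makes that gap the
    largest; the descent on M is well founded. *)
Lemma best_rotation (s : 'I_n -> T) : 3 <= n -> graph_cycle G s ->
  exists s0 M, [/\ graph_cycle G s0, M < n, chords_within s0 M &
    forall r M', r < n -> M' < M -> ~~ chords_within (rotate s0 r) M'].
Proof.
move=> n3; have n0 : 0 < n by apply: ltn_trans n3.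
have: chords_within s n.-1.
  by apply/forallP => i; apply/implyP => _; rewrite -ltnS prednK.
have: n.-1 < n by rewrite prednK.
move: n.-1 => M; elim/ltn_ind: M s => M IH s Mn sM sG.
have [/existsP[r /existsP[M' rM']]|no] :=
    boolP [exists r : 'I_n, exists M' : 'I_M, chords_within (rotate s r) M'].
  by apply: IH rM' _ => //; [apply: ltn_trans Mn|apply: rotate_cycle].
exists s, M; split=> // r M' rn M'M; apply: contra no => rM'.
by apply/existsP; exists (Ordinal rn); apply/existsP; exists (Ordinal M'M).
Qed.

Lemma modn_wrap j r : j < n -> r < n ->
  (j + r) %% n = if j + r < n then j + r else j + r - n.
Proof.
move=> jn rn; case: ltnP => [/modn_small//|nj].
by rewrite -{1}(subnK nj) modnDr modn_small //; lia.
Qed.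

Lemma pancyclic_card : #|T| = n -> 3 <= n -> pancyclic G -> n <= #|edges G|.
Proof.
move=> cardT n3 pG; have nT : n < #|T|.+1 by rewrite cardT.
have := forallP pG (Ordinal nT); rewrite /= n3 => /has_cycle_graph_cycle[_ [s sG]].
by rewrite (card_edges_chords n3 sG) leq_addr.
Qed.

(** A rotation that starts at the first endpoint, or at the end of an interval
    free of endpoints, brings the endpoints within a smaller bound unless the
    first endpoint is at 0 and the interval is no longer than the last gap. *)
Lemma pancyclic_search k ns : #|T| = n -> 3 < n -> n \in ns -> pancyclic G ->
  #|edges G| = n + k -> 0 < k /\ pancyclic_candidate k ns.
Proof.
move=> cardT n4 nns pG eG; have n3 : 3 <= n := ltnW n4.
have cyc l : 3 <= l <= n -> has_cycle G l.
  move=> /andP[l3 ln]; have lT : l < #|T|.+1 by rewrite cardT.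
  by have := forallP pG (Ordinal lT); rewrite /= l3.
have [_ [s1 s1G]] : 3 <= n /\ exists c : 'I_n -> T, graph_cycle G c.
  by apply: has_cycle_graph_cycle; apply: cyc; rewrite n3 leqnn.
have [s [M [sG Mn sM Mmin]]] := best_rotation n3 s1G.
have kE : #|chords G s| = k.
  by apply/eqP; rewrite -(eqn_add2l n) -eG (card_edges_chords n3 sG).
have {}cyc l : 3 <= l < n -> has_cycle G l.
  by move=> /andP[l3 /ltnW ln]; apply: cyc; rewrite l3.
have k0 : 0 < k.
  have l3 : 3 <= 3 < n by rewrite leqnn.
  have [sg [e [sz nz _ _]]] := cycle_attains n3 cardT sG l3 (cyc 3 l3).
  rewrite -kE -sz; by case: sg nz {sz}.
split=> //.
pose p := left_end G s; pose q := right_end G s.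
have ltpq t : t < k -> p t < q t by rewrite -kE; apply: left_lt_right.
have qn t : t < k -> q t < n by rewrite -kE; apply: right_lt.
have pn t : t < k -> p t < n by move=> tk; exact: ltn_trans (ltpq t tk) (qn t tk).
have p_mono t u : t <= u < k -> p t <= p u by rewrite -kE; apply: left_end_mono.
have endM t : t < k -> q t <= M.
  move=> tk; have /forallP/(_ (Ordinal (qn t tk)))/implyP := sM; apply.
  by apply/(chord_end_pos cardT sG); exists t; rewrite ?kE //= eqxx orbT.
have rot r M' (Q : nat -> Prop) : r < n -> M' < M ->
    (forall t, t < k -> Q (p t) /\ Q (q t)) ->
    exists2 j, j < n & Q ((j + r) %% n) /\ M' < j.
  move=> rn M'M tQ; have := Mmin r M' rn M'M; rewrite negb_forall => /existsP[j].
  rewrite negb_imply -ltnNge => /andP[jE jM]; exists j => //; split=> //.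
  rewrite -val_iter_ordS; move: jE; rewrite /chords rotate_edges // -/(chords G s).
  case/(chord_end_pos cardT sG) => t; rewrite kE => /tQ[pQ qQ].
  by case/orP=> /eqP->.
have p0 : p 0 = 0.
  apply/eqP; rewrite -leqn0 leqNgt; apply/negP => p00.
  have p0M : p 0 < M := leq_trans (ltpq 0 k0) (endM 0 k0).
  have [|t tk|j jn] := rot (p 0) (M - p 0) (fun x => p 0 <= x <= M) (pn 0 k0).
  - by lia.
  - by have := p_mono 0 t; have := ltpq t tk; have := endM t tk; rewrite tk; lia.
  by rewrite modn_wrap ?pn //; case: ltnP; lia.
have gap a b : a < b < n ->
    (forall t, t < k -> ((p t <= a) || (b <= p t)) && ((q t <= a) || (b <= q t))) ->
    b - a <= n - M.
  move=> /andP[ab bn] abP; rewrite leqNgt; apply/negP => lt.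
  have [|t tk|j jn] := rot b (n - (b - a)) (fun x => (x <= a) || (b <= x)) bn; first by lia.
    by apply/andP; apply: abP.
  by rewrite modn_wrap //; case: ltnP; lia.
apply: (arrangement_search k0 ltpq endM Mn p_mono p0 gap nns) => l ln.
by rewrite -kE; apply: cycle_attains (cyc l ln).
Qed.
End Rotation.

(** * Checking explicit pancyclic graphs *)

(** Edges are listed with their smaller end first. *)
Definition links (n : nat) (ch : seq (nat * nat)) : seq (nat * nat) :=
  (0, n.-1) :: [seq (i, i.+1) | i <- iota 0 n.-1] ++ ch.

Definition chorded_edges (n : nat) (ch : seq (nat * nat)) : {set {set 'I_n}} :=
  [set [set x.1; x.2] | x : 'I_n * 'I_n
     & (x.1 < x.2) && ((x.1 : nat, x.2 : nat) \in links n ch)].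

Lemma chorded_pairs n ch : [forall e in chorded_edges n ch, #|e| == 2].
Proof.
apply/forall_inP => e /imsetP[[i j]]; rewrite inE => /andP[/= ij _] ->.
by rewrite cards2; case: (i =P j) ij => /= [->|_ _]; [rewrite ltnn|].
Qed.

Definition chorded (n : nat) (ch : seq (nat * nat)) : sgraph 'I_n :=
  SGraph (chorded_pairs n ch).

Lemma card_chorded n ch : 0 < n -> #|edges (chorded n ch)| <= n + size ch.
Proof.
move=> n0; apply: leq_trans (leq_imset_card _ _) _.
have -> : n + size ch = size (links n ch).
  by rewrite /= size_cat size_map size_iota -addSn prednK.
rewrite cardE -(size_map (fun x : 'I_n * 'I_n => (x.1 : nat, x.2 : nat))).
apply: uniq_leq_size => [|x /mapP[y]]; last by rewrite mem_enum inE => /andP[_ ?] ->.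
rewrite map_inj_uniq ?enum_uniq // => -[i j] [i' j'] [ii jj].
by congr (_, _); apply: val_inj.
Qed.

(** A form of adjacency that is cheap to compute. *)
Definition linked (n : nat) (ch : seq (nat * nat)) : rel nat := fun x y =>
  [|| y == x.+1, x == y.+1, (x == 0) && (y == n.-1), (y == 0) && (x == n.-1) |
      has (fun c => ((c.1 == x) && (c.2 == y)) || ((c.1 == y) && (c.2 == x))) ch].

Definition chords_ok (n : nat) (ch : seq (nat * nat)) : bool :=
  all (fun c => c.1 < c.2) ch.

Lemma linked_adj n ch (x y : 'I_n) : 3 <= n -> chords_ok n ch ->
  linked n ch x y -> adj (chorded n ch) x y.
Proof.
move=> n3 chP.
have link (i j : 'I_n) : i < j -> (i : nat, j : nat) \in links n ch ->
    adj (chorded n ch) i j /\ adj (chorded n ch) j i.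
  move=> ij lij; rewrite /adj /= [[set j; i]]setUC.
  by split; apply/imsetP; exists (i, j); rewrite // inE ij.
have succ (i j : 'I_n) : j = i.+1 :> nat -> (i < j) && ((i : nat, j : nat) \in links n ch).
  move=> ij; rewrite ij ltnSn inE mem_cat (map_f (fun i => (i, i.+1))) ?orbT //.
  by rewrite mem_iota; have := ltn_ord j; lia.
have wrap (i j : 'I_n) : i = 0 :> nat -> j = n.-1 :> nat ->
    (i < j) && ((i : nat, j : nat) \in links n ch).
  by move=> i0 jn; rewrite i0 jn inE eqxx; case: n n3 {x y i j i0 jn chP link succ} => [|[|[]]].
have chord (i j : 'I_n) c : c \in ch -> c.1 = i -> c.2 = j ->
    (i < j) && ((i : nat, j : nat) \in links n ch).
  move=> cch ci cj; rewrite -ci -cj (allP chP) //= inE mem_cat -surjective_pairing cch.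
  by rewrite !orbT.
case/or4P => [/eqP/succ/andP[]/link H/H[]//|/eqP/succ/andP[]/link H/H[]//||].
  by case/andP=> /eqP xE /eqP yE; have /andP[/link H /H[]] := wrap _ _ xE yE.
case/orP.
  by case/andP=> /eqP xE /eqP yE; have /andP[/link H /H[]] := wrap _ _ xE yE.
case/hasP=> c cch /orP[]/andP[/eqP c1 /eqP c2].
  by have /andP[/link H /H[]] := chord _ _ c cch c1 c2.
by have /andP[/link H /H[]] := chord _ _ c cch c1 c2.
Qed.

Definition valid_cycle (n : nat) (ch : seq (nat * nat)) (c : seq nat) : bool :=
  [&& all (fun x => x < n) c, cycle (linked n ch) c & uniq c].

Lemma valid_has_cycle n ch c : 3 <= n -> chords_ok n ch -> 3 <= size c ->
  valid_cycle n ch c -> has_cycle (chorded n ch) (size c).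
Proof.
move=> n3 chP c3 /and3P[cn cc uc]; rewrite /has_cycle c3 /=.
have [c' c'E] : exists c' : seq 'I_n, map val c' = c.
  elim: c cn {c3 cc uc} => [|x c IH] /=; first by exists [::].
  by move=> /andP[xn /IH[c' <-]]; exists (Ordinal xn :: c').
have sc' : size c' == size c by rewrite -c'E size_map.
apply/existsP; exists (Tuple sc'); rewrite /ucycleb /= andbC.
move: uc cc; rewrite -c'E map_inj_uniq; last exact: val_inj.
move=> -> /=; rewrite cycle_map; apply: sub_cycle => x y; exact: linked_adj.
Qed.

(** Walks from cur without turning back to prev, until stop is reached. *)
Fixpoint walk (next : nat -> seq nat) (fuel stop prev cur : nat) : seq nat :=
  cur :: if fuel is f.+1
         then if cur == stop then [::]
              else walk next f stop cur
                (head cur (filter (fun x => x != prev) (next cur)))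
         else [::].

(** The component that contains the first selected chord, in the even set given
    by sg and e; without chords, the Hamiltonian cycle.  The lists produced are
    only candidates, filtered by [valid_cycle]. *)
Definition trace (n : nat) (ch : seq (nat * nat)) (sg : seq bool) (e : bool) : seq nat :=
  let used := mask sg ch in
  let side := [seq e (+) odd (count (fun c => (c.1 <= i) != (c.2 <= i)) used) | i <- iota 0 n] in
  let next x :=
    let pred := if x is y.+1 then y else n.-1 in
    (if nth false side x then [:: if x.+1 == n then 0 else x.+1] else [::]) ++
    (if nth false side pred then [:: pred] else [::]) ++
    [seq c.2 | c <- used & c.1 == x] ++ [seq c.1 | c <- used & c.2 == x] in
  if used is c :: _ then walk next n c.2 c.2 c.1 else iota 0 n.

Definition pancyclic_check (n : nat) (ch : seq (nat * nat)) : bool :=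
  let cs := [seq c <- flatten [seq [:: trace n ch sg false; trace n ch sg true]
                              | sg <- masks (size ch)] | valid_cycle n ch c] in
  let sizes := map size cs in
  chords_ok n ch && all (fun l => l \in sizes) (iota 3 (n - 2)).

Lemma pancyclic_check_sound n ch :
  3 <= n -> pancyclic_check n ch -> pancyclic (chorded n ch).
Proof.
move=> n3 /andP[chP /allP H]; apply/forallP => l; apply/implyP => l3.
have ln : l <= n by rewrite -[n in _ <= n]card_ord -ltnS ltn_ord.
move: (nat_of_ord l) l3 ln => {}l l3 ln.
have /mapP[c] : l \in [seq size c | c <- [seq c <- flatten
    [seq [:: trace n ch sg false; trace n ch sg true] | sg <- masks (size ch)]
    | valid_cycle n ch c]].
  by apply: H; rewrite mem_iota l3 /=; lia.
rewrite mem_filter => /andP[cv _] lE; rewrite lE; apply: valid_has_cycle => //.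
by rewrite -lE.
Qed.

(** * The values of m *)

(** The number of edges beyond n. *)
Definition excess (n : nat) : nat :=
  if n <= 3 then 0 else if n <= 5 then 1 else if n <= 8 then 2
  else if n <= 14 then 3 else if n <= 24 then 4 else 5.

(** Chords to be added to the cycle 0, 1, ..., n - 1, for n = 3, 4, ..., 37. *)
Definition chord_table : seq (seq (nat * nat)) := [::
  [::];
  [:: (0, 2)];
  [:: (0, 2)];
  [:: (0, 2); (0, 3)];
  [:: (0, 2); (0, 3)];
  [:: (0, 2); (0, 5)];
  [:: (0, 2); (0, 3); (0, 4)];
  [:: (0, 2); (0, 3); (0, 6)];
  [:: (0, 2); (0, 3); (0, 7)];
  [:: (0, 2); (0, 4); (1, 7)];
  [:: (0, 2); (0, 4); (1, 7)];
  [:: (0, 2); (0, 4); (1, 7)];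
  [:: (0, 2); (0, 3); (0, 7); (0, 11)];
  [:: (0, 4); (1, 3); (1, 7); (1, 10)];
  [:: (0, 5); (1, 3); (1, 8); (1, 10)];
  [:: (0, 2); (0, 3); (0, 5); (1, 9)];
  [:: (0, 4); (1, 3); (1, 6); (2, 10)];
  [:: (0, 9); (6, 8); (6, 10); (7, 13)];
  [:: (0, 9); (5, 7); (5, 9); (6, 12)];
  [:: (0, 8); (5, 7); (6, 10); (6, 12)];
  [:: (0, 9); (6, 8); (7, 11); (7, 13)];
  [:: (0, 9); (6, 8); (7, 11); (7, 13)];
  [:: (0, 11); (0, 12); (6, 9); (6, 11); (7, 13)];
  [:: (0, 11); (0, 12); (6, 9); (6, 11); (7, 13)];
  [:: (0, 13); (0, 14); (4, 7); (5, 13); (6, 15)];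
  [:: (0, 13); (0, 14); (4, 7); (5, 13); (6, 15)];
  [:: (0, 13); (0, 14); (4, 7); (5, 13); (6, 15)];
  [:: (0, 13); (0, 14); (4, 7); (5, 13); (6, 15)];
  [:: (0, 4); (0, 10); (1, 3); (1, 6); (2, 16)];
  [:: (0, 11); (7, 14); (8, 10); (8, 13); (9, 17)];
  [:: (0, 13); (8, 15); (9, 11); (9, 14); (10, 18)];
  [:: (0, 4); (1, 3); (1, 12); (2, 9); (2, 21)];
  [:: (0, 11); (1, 5); (3, 18); (4, 6); (4, 19)];
  [:: (0, 9); (1, 10); (6, 8); (7, 11); (7, 19)];
  [:: (0, 9); (1, 18); (2, 4); (3, 19); (3, 21)] ].

Definition chords_for (n : nat) : seq (nat * nat) := nth [::] chord_table (n - 3).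

Lemma chord_table_check :
  all (fun n => (size (chords_for n) == excess n) && pancyclic_check n (chords_for n))
      (iota 3 35).
Proof. by vm_compute. Qed.

(** The orders n for which k chords have to be shown insufficient. *)
Definition needs_more_than (k : nat) : seq nat := [seq n <- iota 3 35 | k < excess n].

Lemma search_fails : all (fun k => ~~ pancyclic_candidate k (needs_more_than k)) (iota 1 4).
Proof. by vm_compute. Qed.

Lemma m_pancyclic n :
  (exists2 G : sgraph 'I_n, pancyclic G & #|edges G| = m n) /\
  (forall G : sgraph 'I_n, pancyclic G -> m n <= #|edges G|).
Proof.
rewrite /m; case: ex_minnP => k /existsP[G /andP[pG /eqP eG]] kmin.
split=> [|G' pG']; first by exists G.
by apply: kmin; apply/existsP; exists G'; rewrite pG' eqxx.
Qed.

(** With too few edges, the number k of chords would be among 1, ..., 4 and the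
    search for k would succeed. *)
Lemma m_excess n : 3 <= n <= 37 -> m n = n + excess n.
Proof.
move=> n337; have n3 : 3 <= n by case/andP: n337.
have n_in : n \in iota 3 35 by rewrite mem_iota; lia.
have [[G pG eG] mle] := m_pancyclic n.
apply/eqP; rewrite eqn_leq; apply/andP; split.
  have /andP[/eqP <- chk] := allP chord_table_check n n_in.
  apply: leq_trans (mle _ (pancyclic_check_sound n3 chk)) _.
  by apply: card_chorded; apply: ltn_trans n3.
rewrite leqNgt; apply/negP => lt_m.
have n_le : n <= m n by rewrite -eG; apply: pancyclic_card pG; rewrite ?card_ord.
pose k := m n - n; have kE : #|edges G| = n + k by rewrite eG subnKC.
have k_lt : k < excess n by rewrite -(ltn_add2l n) -kE eG.
have n4 : 3 < n.
  by rewrite ltnNge; apply: contraTN k_lt => n_le3; rewrite /excess n_le3.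
have nk : n \in needs_more_than k by rewrite mem_filter k_lt.
have [k0 cand] := pancyclic_search (card_ord n) n4 nk pG kE.
have k_in : k \in iota 1 4.
  rewrite mem_iota k0; apply: leq_trans k_lt _.
  by rewrite /excess; do 5 case: ifP => // _.
by have /negP := allP search_fails k k_in.
Qed.

Theorem mainTheorem1 :
  m 3 = 3 /\
  (forall n : nat, 4 <= n <= 5 -> m n = n + 1) /\
  (forall n : nat, 6 <= n <= 8 -> m n = n + 2) /\
  (forall n : nat, 9 <= n <= 14 -> m n = n + 3) /\
  (forall n : nat, 15 <= n <= 24 -> m n = n + 4) /\
  (forall n : nat, 25 <= n <= 37 -> m n = n + 5).
Proof.
split; first exact: m_excess.
do !split; move=> n n_rng; rewrite m_excess; try lia; congr (_ + _).
all: by rewrite /excess; do !case: ifP => ?; lia.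
Qed.
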